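(* Let $\mathcal{G}$ be a Riemannian metric on the $2$-torus $\mathbb{T}^2$, let $\mathcal{G}_0$ be the unit area flat metric in the conformal class of $\mathcal{G}$, and let $f>0$ be the conformal factor, so that $\mathcal{G}=f^2\mathcal{G}_0$. Let $\tau\in\mathbb{C}$ lie in the closure of the standard fundamental domain $$D=\bigl\{ z\in\mathbb{C} : |z|>1,\ |\Re(z)|<\tfrac12,\ \Im(z)>0\bigr\}$$ and be such that the lattice of deck transformations of the flat torus $(\mathbb{T}^2,\mathcal{G}_0)$ is similar to $\mathbb{Z}\tau+\mathbb{Z}1\subset\mathbb{C}$, and let $\sigma>0$ be defined by $\sigma^2=\Im(\tau)$. Then $$\operatorname{area}(\mathcal{G}) - \sigma^2\, \operatorname{sys}(\mathcal{G})^2 \;\geq\; \operatorname{Var}(f).$$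
   Context: The systole $\operatorname{sys}(\mathcal{G})$ is the least $\mathcal{G}$-length of a noncontractible loop on $\mathbb{T}^2$; $\operatorname{area}(\mathcal{G})$ is the total area. By the uniformisation theorem, for every metric $\mathcal{G}$ on $\mathbb{T}^2$ there are a lattice $L\subset\mathbb{R}^2=\mathbb{C}$, which may be normalised to have coarea $1$, and a positive $L$-periodic function $f(x,y)$ on $\mathbb{R}^2$ such that $(\mathbb{T}^2,\mathcal{G})$ is isometric to $(\mathbb{R}^2/L,\ f^2(dx^2+dy^2))$. The metric $\mathcal{G}_0=dx^2+dy^2$ on $\mathbb{R}^2/L$ is the unit area flat metric in the conformal class of $\mathcal{G}$, $f$ is the conformal factor, and $L$ is the lattice of deck transformations of the flat torus. Every lattice in $\mathbb{C}$ is similar to one of the form $\mathbb{Z}\tau+\mathbb{Z}1$ with $\tau$ in the closure of $D$. The variance is taken with respect to the probability measure $\mu$ on $\mathbb{T}^2$ given by the area measure of $\mathcal{G}_0$: $\operatorname{Var}(f)=\int_{\mathbb{T}^2}(f-m)^2\,d\mu$, where $m=\int_{\mathbb{T}^2} f\,d\mu$. *)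

(* Defs.v *)
From Stdlib Require Import Reals ZArith.
From Coquelicot Require Import Coquelicot.
Open Scope R_scope.

(* The torus is T^2 = R^2/Z^2; functions, metrics and curves on it are given by
   their lifts to the universal cover R^2. *)

Definition smooth (h : R -> R -> R) : Prop :=
  forall n x y, ex_diff_n h n x y.

Definition periodic (h : R -> R -> R) : Prop :=
  forall x y, h (x + 1) y = h x y /\ h x (y + 1) = h x y.

Definition torus_function (h : R -> R -> R) : Prop :=
  smooth h /\ periodic h.

(* T^2 as a topological space: the unit circles in C x C, with the covering
   map from R^2, whose fibres are the cosets of Z^2. *)
Definition T2 (q : C * C) : Prop := Cmod (fst q) = 1 /\ Cmod (snd q) = 1.

Definition circle (x : R) : C := (cos (2 * PI * x), sin (2 * PI * x)).

Definition proj (p : R * R) : C * C := (circle (fst p), circle (snd p)).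

(* E dx^2 + 2 F dx dy + G dy^2 *)

Record metric := Metric {
  gE : R -> R -> R;
  gF : R -> R -> R;
  gG : R -> R -> R;
  gE_torus : torus_function gE;
  gF_torus : torus_function gF;
  gG_torus : torus_function gG;
  metric_pos : forall x y a b, (a, b) <> (0, 0) ->
    0 < gE x y * a ^ 2 + 2 * gF x y * a * b + gG x y * b ^ 2
}.

Definition qform (g : metric) (p v : R * R) : R :=
  gE g (fst p) (snd p) * fst v ^ 2
  + 2 * gF g (fst p) (snd p) * fst v * snd v
  + gG g (fst p) (snd p) * snd v ^ 2.

Definition area_density (g : metric) (x y : R) : R :=
  sqrt (gE g x y * gG g x y - gF g x y ^ 2).

(* Integral over T^2 against the area measure of g. *)
Definition torus_int (g : metric) (h : R -> R -> R) : R :=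
  RInt (fun x => RInt (fun y => h x y * area_density g x y) 0 1) 0 1.

Definition area (g : metric) : R := torus_int g (fun _ _ => 1).

Definition mean (g : metric) (h : R -> R -> R) : R := torus_int g h.

(* Only meaningful as mean and variance when [area g = 1], i.e. when the area
   measure of g is a probability measure. *)
Definition variance (g : metric) (h : R -> R -> R) : R :=
  torus_int g (fun x y => (h x y - mean g h) ^ 2).

Definition C1 (c : R -> R) : Prop :=
  forall t, ex_derive c t /\ continuous (Derive c) t.

(* On each closed piece, c agrees with a C^1 curve defined on all of R, so that
   one-sided derivatives exist at the break points. *)
Definition piecewise_C1 (c : R -> R * R) : Prop :=
  exists (n : nat) (s : nat -> R),
    s 0%nat = 0 /\ s (S n) = 1 /\
    (forall i, (i <= n)%nat -> s i < s (S i)) /\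
    (forall i, (i <= n)%nat -> exists d : R -> R * R,
       C1 (fun t => fst (d t)) /\ C1 (fun t => snd (d t)) /\
       forall t, s i <= t <= s (S i) -> c t = d t).

(* The values of [Derive] at the finitely many break points do not affect
   the integral. *)
Definition length (g : metric) (c : R -> R * R) : R :=
  RInt (fun t => sqrt (qform g (c t)
                   (Derive (fun s => fst (c s)) t,
                    Derive (fun s => snd (c s)) t))) 0 1.

Definition unit_square (q : R * R) : Prop :=
  0 <= fst q <= 1 /\ 0 <= snd q <= 1.

(* Free homotopy, through loops of T^2, from a loop to a constant one. *)
Definition contractible (l : R -> C * C) : Prop :=
  exists (H : R * R -> C * C) (p : C * C),
    continuous_on unit_square H /\
    (forall q, unit_square q -> T2 (H q)) /\
    (forall t, 0 <= t <= 1 -> H (0, t) = l t) /\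
    (forall t, 0 <= t <= 1 -> H (1, t) = p) /\
    (forall s, 0 <= s <= 1 -> H (s, 0) = H (s, 1)).

(* Every piecewise C^1 loop of T^2 is proj o c for some lift c, which has the
   same length; c itself need not be closed. *)
Definition noncontractible_loop (c : R -> R * R) : Prop :=
  piecewise_C1 c /\ proj (c 0) = proj (c 1) /\
  ~ contractible (fun t => proj (c t)).

Definition sys (g : metric) : R :=
  real (Glb_Rbar (fun l => exists c, noncontractible_loop c /\ l = length g c)).

Definition conformal_factor (g g0 : metric) (f : R -> R -> R) : Prop :=
  torus_function f /\
  forall x y, 0 < f x y /\
    gE g x y = f x y ^ 2 * gE g0 x y /\
    gF g x y = f x y ^ 2 * gF g0 x y /\
    gG g x y = f x y ^ 2 * gG g0 x y.

Definition smooth_map (Phi : R -> R -> R * R) : Prop :=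
  smooth (fun x y => fst (Phi x y)) /\ smooth (fun x y => snd (Phi x y)).

Definition diffeomorphism (Phi : R -> R -> R * R) : Prop :=
  smooth_map Phi /\
  exists Psi : R -> R -> R * R, smooth_map Psi /\
    (forall x y, Psi (fst (Phi x y)) (snd (Phi x y)) = (x, y)) /\
    (forall u v, Phi (fst (Psi u v)) (snd (Psi u v)) = (u, v)).

(* g0 is the pullback of du^2 + dv^2 under Phi = (u, v). *)
Definition euclidean_pullback (g0 : metric) (Phi : R -> R -> R * R) : Prop :=
  let u x y := fst (Phi x y) in
  let v x y := snd (Phi x y) in
  forall x y,
    let ux := Derive (fun t => u t y) x in
    let uy := Derive (fun t => u x t) y in
    let vx := Derive (fun t => v t y) x in
    let vy := Derive (fun t => v x t) y in
    gE g0 x y = ux ^ 2 + vx ^ 2 /\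
    gF g0 x y = ux * uy + vx * vy /\
    gG g0 x y = uy ^ 2 + vy ^ 2.

(* Under Phi, the deck transformation (x, y) |-> (x + m, y + n) of R^2 -> T^2
   becomes the translation of C by w. *)
Definition deck_translation (Phi : R -> R -> C) (m n : Z) (w : C) : Prop :=
  forall x y, Phi (x + IZR m) (y + IZR n) = Cplus (Phi x y) w.

(* (T^2, g0) is flat with lattice of deck transformations L: an isometry Phi
   from the universal cover of (T^2, g0) to the Euclidean plane C conjugates
   the deck group Z^2 to the group of translations by L; equivalently, Phi
   induces an isometry from (T^2, g0) to C/L. *)
Definition flat_with_deck_lattice (g0 : metric) (L : C -> Prop) : Prop :=
  exists Phi : R -> R -> C,
    diffeomorphism Phi /\ euclidean_pullback g0 Phi /\
    (forall m n, exists w, L w /\ deck_translation Phi m n w) /\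
    (forall w, L w -> exists m n, deck_translation Phi m n w).

Definition lattice_of (tau : C) (z : C) : Prop :=
  exists m n : Z, z = Cplus (Cmult (RtoC (IZR m)) tau) (RtoC (IZR n)).

Definition similar (L L' : C -> Prop) : Prop :=
  exists c : C, c <> RtoC 0 /\
    forall z, L z <-> exists w, L' w /\ z = Cmult c w.

Definition fundamental_domain (z : C) : Prop :=
  1 < Cmod z /\ Rabs (Re z) < 1 / 2 /\ 0 < Im z.

Definition closure (A : C -> Prop) (z : C) : Prop :=
  forall eps : posreal, exists w, A w /\ Cmod (Cminus w z) < eps.

(* Main.v *)
Require Import Defs.
From Stdlib Require Import Reals ZArith Lra Lia.
From Coquelicot Require Import Coquelicot.
Open Scope R_scope.

(* The variance identity turns the claim into [sigma * sys g <= mean f]. Let [c]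
   be the vector of the deck lattice corresponding to [1] in [Z tau + Z]. The
   area normalisation gives [|c|^2 sigma^2 <= 1]. The flat segments from [z] to
   [z + c] are noncontractible loops whose g-length is [|c|] times the integral
   of [f] along them, and averaging them over all base points [z] of the torus
   gives exactly [|c| * mean f], since translations preserve the flat area.
   Working on the given fundamental square, this invariance and the area of
   the flat torus both come from integrating a divergence by parts, so no
   change of variables is needed. *)

(** * Calculus in the plane *)

(** Under [Phi] the unit square becomes a curvilinear fundamental domain, and translating it by
    [r c] moves it off itself, so invariance of the average cannot be read off the domain of
    integration. Instead the error (average of [k] over a segment minus its initial value) is
    written as the derivative along [c] of one explicit function with the same periods as [k].
    Pulled back by [Phi] and multiplied by the Jacobian, it is again a Jacobian determinant, of a
    periodic function and a quasi-periodic one, and integrates to 0. Contractibility is a statement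
    about loops and homotopies in the circles themselves, with no lift provided, so a winding number
    is built by hand from small angle increments. *)

Definition continuous_2d (h : R -> R -> R) : Prop :=
  forall x y, continuity_2d_pt h x y.

Definition C1_2d (h hx hy : R -> R -> R) : Prop :=
  (forall x y, is_derive (fun t => h t y) x (hx x y)) /\
  (forall x y, is_derive (fun t => h x t) y (hy x y)) /\
  continuous_2d hx /\ continuous_2d hy.

Lemma continuous_2d_comp (h u v : R -> R -> R) :
  continuous_2d h -> continuous_2d u -> continuous_2d v ->
  continuous_2d (fun x y => h (u x y) (v x y)).
Proof.
  intros Hh Hu Hv x y eps.
  destruct (Hh (u x y) (v x y) eps) as [d Hd].
  destruct (Hu x y d) as [du Hdu]. destruct (Hv x y d) as [dv Hdv].
  assert (Hm : 0 < Rmin du dv) by (apply Rmin_pos; apply cond_pos).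
  exists (mkposreal _ Hm). simpl. intros x' y' Hx Hy.
  pose proof (Rmin_l du dv). pose proof (Rmin_r du dv).
  apply Hd; [apply Hdu | apply Hdv]; lra.
Qed.

Lemma continuous_2d_plus (h k : R -> R -> R) :
  continuous_2d h -> continuous_2d k -> continuous_2d (fun x y => h x y + k x y).
Proof. intros Hh Hk x y. now apply continuity_2d_pt_plus. Qed.

Lemma continuous_2d_minus (h k : R -> R -> R) :
  continuous_2d h -> continuous_2d k -> continuous_2d (fun x y => h x y - k x y).
Proof. intros Hh Hk x y. now apply continuity_2d_pt_minus. Qed.

Lemma continuous_2d_mult (h k : R -> R -> R) :
  continuous_2d h -> continuous_2d k -> continuous_2d (fun x y => h x y * k x y).
Proof. intros Hh Hk x y. now apply continuity_2d_pt_mult. Qed.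

Lemma continuous_2d_const (c : R) : continuous_2d (fun _ _ => c).
Proof. intros x y. apply continuity_2d_pt_const. Qed.

Lemma continuous_2d_fst : continuous_2d (fun x _ => x).
Proof. intros x y. apply continuity_2d_pt_id1. Qed.

Lemma continuous_2d_snd : continuous_2d (fun _ y => y).
Proof. intros x y. apply continuity_2d_pt_id2. Qed.

Lemma continuous_2d_ext (h k : R -> R -> R) :
  (forall x y, h x y = k x y) -> continuous_2d h -> continuous_2d k.
Proof. intros E H x y. now apply (continuity_2d_pt_ext h k). Qed.

Lemma continuous_2d_curve (h : R -> R -> R) (a b : R -> R) (t : R) :
  continuous_2d h -> continuous a t -> continuous b t ->
  continuous (fun s => h (a s) (b s)) t.
Proof.
  intros Hh Ha Hb. apply continuous_comp_2; auto.
  apply continuity_2d_pt_filterlim, Hh.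
Qed.

Lemma continuous_2d_slice_r (h : R -> R -> R) (x y : R) :
  continuous_2d h -> continuous (fun t => h x t) y.
Proof.
  intros H. apply continuous_2d_curve; auto.
  apply continuous_const. apply continuous_id.
Qed.

Lemma continuous_2d_slice_l (h : R -> R -> R) (x y : R) :
  continuous_2d h -> continuous (fun t => h t y) x.
Proof.
  intros H. apply (continuous_2d_curve h (fun t => t) (fun _ => y)); auto.
  apply continuous_id. apply continuous_const.
Qed.

Lemma continuous_2d_abs (h : R -> R -> R) :
  continuous_2d h -> continuous_2d (fun x y => Rabs (h x y)).
Proof.
  intros Hh x y. apply continuity_1d_2d_pt_comp; auto.
  apply Rcontinuity_abs.
Qed.

Lemma RInt_ext_R (f g : R -> R) (a b : R) :
  (forall t, f t = g t) -> RInt f a b = RInt g a b.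
Proof. intros E. apply RInt_ext. intros t _. apply E. Qed.

Lemma RInt_plus_R (f g : R -> R) (a b : R) :
  ex_RInt f a b -> ex_RInt g a b ->
  RInt (fun t => f t + g t) a b = RInt f a b + RInt g a b.
Proof. apply (RInt_plus (V := R_CompleteNormedModule)). Qed.

Lemma RInt_minus_R (f g : R -> R) (a b : R) :
  ex_RInt f a b -> ex_RInt g a b ->
  RInt (fun t => f t - g t) a b = RInt f a b - RInt g a b.
Proof. apply (RInt_minus (V := R_CompleteNormedModule)). Qed.

Lemma RInt_scal_R (f : R -> R) (a b c : R) :
  ex_RInt f a b -> RInt (fun t => c * f t) a b = c * RInt f a b.
Proof. apply (RInt_scal (V := R_CompleteNormedModule)). Qed.

Lemma ex_RInt_slice (h : R -> R -> R) (x a b : R) :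
  continuous_2d h -> ex_RInt (fun y => h x y) a b.
Proof.
  intros Hh. apply @ex_RInt_continuous. intros y _.
  now apply continuous_2d_slice_r.
Qed.

Lemma continuous_RInt_param (h : R -> R -> R) (x : R) :
  continuous_2d h -> continuous (fun s => RInt (fun y => h s y) 0 1) x.
Proof.
  intros Hh. apply continuity_pt_filterlim.
  intros eps Heps.
  assert (Heps2 : 0 < eps / 2) by lra.
  destruct (uniform_continuity_2d_1d' h 0 1 x (fun y _ => Hh x y)
              (mkposreal _ Heps2)) as [d Hd]. simpl in Hd.
  exists d. split; [apply cond_pos|].
  intros s [_ Hs]. simpl in *. unfold Rdist in *.
  rewrite <- RInt_minus_R by (apply ex_RInt_slice; auto).
  eapply Rle_lt_trans; [apply (abs_RInt_le_const _ 0 1 (eps / 2))|].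
  - lra.
  - apply @ex_RInt_minus; apply ex_RInt_slice; auto.
  - intros t Ht. left. apply Hd; try lra.
    + pose proof (cond_pos d). lra.
    + apply Rabs_def2 in Hs. lra.
    + rewrite Rminus_eq_0, Rabs_R0. apply cond_pos.
  - lra.
Qed.

Lemma C1_2d_differentiable (h hx hy : R -> R -> R) (x y : R) :
  C1_2d h hx hy -> differentiable_pt_lim h x y (hx x y) (hy x y).
Proof.
  intros (H1 & H2 & H3 & _). apply filterdiff_differentiable_pt_lim.
  apply (is_derive_filterdiff h x y hx (hy x y)).
  - exists (mkposreal 1 Rlt_0_1). intros z _. apply H1.
  - apply H2.
  - apply continuity_2d_pt_filterlim, H3.
Qed.

Lemma C1_2d_continuous (h hx hy : R -> R -> R) :
  C1_2d h hx hy -> continuous_2d h.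
Proof.
  intros H x y. apply differentiable_continuity_pt.
  exists (hx x y), (hy x y). now apply C1_2d_differentiable.
Qed.

Lemma is_derive_curve (h hx hy : R -> R -> R) (a b : R -> R) (t da db : R) :
  C1_2d h hx hy -> is_derive a t da -> is_derive b t db ->
  is_derive (fun s => h (a s) (b s)) t
    (hx (a t) (b t) * da + hy (a t) (b t) * db).
Proof.
  intros H Ha Hb. apply is_derive_Reals. apply derivable_pt_lim_comp_2d.
  - now apply C1_2d_differentiable.
  - now apply is_derive_Reals.
  - now apply is_derive_Reals.
Qed.

Lemma C1_2d_comp (h hx hy u ux uy v vx vy : R -> R -> R) :
  C1_2d h hx hy -> C1_2d u ux uy -> C1_2d v vx vy ->
  C1_2d (fun x y => h (u x y) (v x y))
    (fun x y => hx (u x y) (v x y) * ux x y + hy (u x y) (v x y) * vx x y)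
    (fun x y => hx (u x y) (v x y) * uy x y + hy (u x y) (v x y) * vy x y).
Proof.
  intros Hh Hu Hv.
  pose proof (C1_2d_continuous _ _ _ Hu). pose proof (C1_2d_continuous _ _ _ Hv).
  pose proof Hh as (_ & _ & Hhx & Hhy).
  destruct Hu as (Hu1 & Hu2 & Hu3 & Hu4). destruct Hv as (Hv1 & Hv2 & Hv3 & Hv4).
  split; [|split; [|split]].
  - intros x y. apply (is_derive_curve h hx hy (fun s => u s y) (fun s => v s y)); auto.
  - intros x y. apply (is_derive_curve h hx hy (fun s => u x s) (fun s => v x s)); auto.
  - apply continuous_2d_plus; apply continuous_2d_mult; auto;
      apply continuous_2d_comp; auto.
  - apply continuous_2d_plus; apply continuous_2d_mult; auto;
      apply continuous_2d_comp; auto.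
Qed.

Lemma is_derive_RInt_param_C1 (h hx : R -> R -> R) (x : R) :
  (forall s t, is_derive (fun z => h z t) s (hx s t)) ->
  continuous_2d h -> continuous_2d hx ->
  is_derive (fun s => RInt (fun t => h s t) 0 1) x (RInt (fun t => hx x t) 0 1).
Proof.
  intros Hd Hh Hhx.
  rewrite (RInt_ext (fun t => hx x t) (fun t => Derive (fun u => h u t) x)).
  2:{ intros t _. symmetry. now apply is_derive_unique. }
  apply (is_derive_RInt_param h 0 1 x).
  - exists (mkposreal 1 Rlt_0_1). intros s _ t _. eexists. apply Hd.
  - intros t _. apply (continuity_2d_pt_ext hx); auto.
    intros s r. symmetry. now apply is_derive_unique.
  - exists (mkposreal 1 Rlt_0_1). intros s _. now apply ex_RInt_slice.
Qed.

(** * Integrals over the unit square *)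

Definition square_int (h : R -> R -> R) : R :=
  RInt (fun x => RInt (fun y => h x y) 0 1) 0 1.

Lemma ex_RInt_square (h : R -> R -> R) :
  continuous_2d h -> ex_RInt (fun x => RInt (fun y => h x y) 0 1) 0 1.
Proof.
  intros H. apply @ex_RInt_continuous. intros x _. now apply continuous_RInt_param.
Qed.

Lemma square_int_ext (h k : R -> R -> R) :
  (forall x y, h x y = k x y) -> square_int h = square_int k.
Proof.
  intros E. apply RInt_ext_R. intros x. apply RInt_ext_R. intros y. apply E.
Qed.

Lemma square_int_plus (h k : R -> R -> R) :
  continuous_2d h -> continuous_2d k ->
  square_int (fun x y => h x y + k x y) = square_int h + square_int k.
Proof.
  intros Hh Hk. unfold square_int.
  rewrite <- RInt_plus_R by now apply ex_RInt_square.
  apply RInt_ext_R. intros x.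
  apply RInt_plus_R; now apply ex_RInt_slice.
Qed.

Lemma square_int_scal (c : R) (h : R -> R -> R) :
  continuous_2d h -> square_int (fun x y => c * h x y) = c * square_int h.
Proof.
  intros Hh. unfold square_int.
  transitivity (RInt (fun x => c * RInt (fun y => h x y) 0 1) 0 1).
  - apply RInt_ext_R. intros x.
    apply RInt_scal_R; now apply ex_RInt_slice.
  - apply RInt_scal_R; now apply ex_RInt_square.
Qed.

Lemma square_int_le (h k : R -> R -> R) :
  continuous_2d h -> continuous_2d k -> (forall x y, h x y <= k x y) ->
  square_int h <= square_int k.
Proof.
  intros Hh Hk Hle. apply RInt_le; try apply ex_RInt_square; auto; try lra.
  intros x _. apply RInt_le; try apply ex_RInt_slice; auto; lra.
Qed.

Lemma is_derive_mult_R (f g : R -> R) (x df dg : R) :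
  is_derive f x df -> is_derive g x dg ->
  is_derive (fun t => f t * g t) x (df * g x + f x * dg).
Proof. intros Hf Hg. apply (is_derive_mult f g); auto. intros; apply Rmult_comm. Qed.

Lemma is_derive_plus_const (f : R -> R) (c x df : R) :
  is_derive f x df -> is_derive (fun s => f s + c) x df.
Proof.
  intros Hf. replace df with (df + 0) by ring.
  apply (is_derive_plus f (fun _ => c)); auto. apply (is_derive_const c x).
Qed.

Lemma RInt_of_is_derive (f df : R -> R) :
  (forall x, is_derive f x (df x)) -> (forall x, continuous df x) ->
  RInt df 0 1 = f 1 - f 0.
Proof.
  intros H1 H2. apply is_RInt_unique. apply (is_RInt_derive f df); auto.
Qed.

(* The integrand is the divergence of the field [(h t_y, - h t_x)], whose flux
   through opposite sides of the square cancels up to the quasi-periods. *)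
Lemma jacobian_integral (h hx hy t tx ty txy : R -> R -> R) (a b a' b' : R) :
  C1_2d h hx hy -> C1_2d t tx ty ->
  (forall x y, is_derive (fun s => ty s y) x (txy x y)) ->
  (forall x y, is_derive (fun s => tx x s) y (txy x y)) ->
  continuous_2d txy ->
  (forall x y, h (x + 1) y = h x y + a /\ h x (y + 1) = h x y + b) ->
  (forall x y, t (x + 1) y = t x y + a' /\ t x (y + 1) = t x y + b') ->
  square_int (fun x y => hx x y * ty x y - hy x y * tx x y) = a * b' - b * a'.
Proof.
  intros Hh Ht Htyx Htxy Hc Ph Pt.
  pose proof (C1_2d_continuous _ _ _ Hh) as Ch.
  pose proof (C1_2d_continuous _ _ _ Ht) as Ct.
  destruct Hh as (Hh1 & Hh2 & Hh3 & Hh4). destruct Ht as (Ht1 & Ht2 & Ht3 & Ht4).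
  (* [P] is the x-derivative of [h ty] and [Q] the y-derivative of [h tx]; the terms with [txy]
     cancel in [P - Q]. *)
  set (P x y := hx x y * ty x y + h x y * txy x y).
  set (Q x y := hy x y * tx x y + h x y * txy x y).
  assert (CP : continuous_2d P)
    by (apply continuous_2d_plus; apply continuous_2d_mult; auto).
  assert (CQ : continuous_2d Q)
    by (apply continuous_2d_plus; apply continuous_2d_mult; auto).
  transitivity (square_int (fun x y => P x y + (-1) * Q x y)).
  { apply square_int_ext. intros. unfold P, Q. ring. }
  rewrite square_int_plus; auto.
  2:{ apply continuous_2d_mult; auto. apply continuous_2d_const. }
  rewrite square_int_scal by auto.
  (* The quasi-periods of [t] are constants, so they disappear from its partial derivatives, which
     are periodic. *)
  assert (Ptx : forall x, tx x 1 = tx x 0).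
  { intros x. transitivity (Derive (fun s => t s 0 + b') x).
    - symmetry. rewrite <- (Derive_ext (fun s => t s 1)).
      + now apply is_derive_unique.
      + intros s. replace 1 with (0 + 1) by ring. apply Pt.
    - apply is_derive_unique. apply is_derive_plus_const, Ht1. }
  assert (Pty : forall y, ty 1 y = ty 0 y).
  { intros y. transitivity (Derive (fun s => t 0 s + a') y).
    - symmetry. rewrite <- (Derive_ext (fun s => t 1 s)).
      + now apply is_derive_unique.
      + intros s. replace 1 with (0 + 1) by ring. apply Pt.
    - apply is_derive_unique. apply is_derive_plus_const, Ht2. }
  (* [P] is a derivative in the outer variable: differentiating under the inner integral takes the
     place of swapping the order of integration. *)
  assert (IP : square_int P = a * b').
  { unfold square_int.
    rewrite (RInt_of_is_derive (fun x => RInt (fun y => h x y * ty x y) 0 1)).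
    - rewrite <- RInt_minus_R
        by (apply (ex_RInt_slice (fun x y => h x y * ty x y)); now apply continuous_2d_mult).
      transitivity (RInt (fun y => a * ty 0 y) 0 1).
      + apply RInt_ext_R. intros y. rewrite Pty.
        replace 1 with (0 + 1) at 1 by ring. rewrite (proj1 (Ph 0 y)).
        ring.
      + rewrite RInt_scal_R by now apply ex_RInt_slice.
        rewrite (RInt_of_is_derive (fun y => t 0 y)); auto.
        * replace 1 with (0 + 1) by ring. rewrite (proj2 (Pt 0 0)).
          ring.
        * intros; now apply continuous_2d_slice_r.
    - intros x. apply (is_derive_RInt_param_C1 (fun x y => h x y * ty x y)); auto.
      + intros s r. apply (is_derive_mult_R (fun z => h z r) (fun z => ty z r)); auto.
      + now apply continuous_2d_mult.
    - intros x. now apply continuous_RInt_param. }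
  assert (IQ : square_int Q = b * a').
  { unfold square_int. transitivity (RInt (fun x => b * tx x 0) 0 1).
    - apply RInt_ext_R. intros x.
      rewrite (RInt_of_is_derive (fun y => h x y * tx x y)).
      + rewrite Ptx. replace 1 with (0 + 1) by ring. rewrite (proj2 (Ph x 0)). ring.
      + intros y. apply (is_derive_mult_R (fun z => h x z) (fun z => tx x z)); auto.
      + intros y. now apply continuous_2d_slice_r.
    - rewrite RInt_scal_R.
      + rewrite (RInt_of_is_derive (fun x => t x 0)); auto.
        * replace 1 with (0 + 1) by ring. rewrite (proj1 (Pt 0 0)).
          ring.
        * intros; now apply continuous_2d_slice_l.
      + apply @ex_RInt_continuous. intros x _. now apply continuous_2d_slice_l. }
  rewrite IP, IQ. ring.
Qed.

(* If f is not integrable, [RInt f 0 1] is [iota] of an empty predicate, which is 0. *)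
Lemma RInt_nonneg (f : R -> R) :
  (forall t, 0 <= f t) -> 0 <= RInt f 0 1.
Proof.
  intros Hf. destruct (Classical_Prop.classic (ex_RInt f 0 1)) as [H|H].
  - apply RInt_ge_0; auto; lra.
  - unfold RInt, iota, lim. simpl. unfold R_complete_lim.
    (* Vacuously, every real lies in the set whose supremum defines the limit; the supremum is
       [p_infty], which [real] sends to 0. *)
    rewrite (is_lub_Rbar_unique _ p_infty). simpl; lra.
    split; [intros x _; exact I|].
    intros [b| |] Hb; simpl; auto.
    + assert (b + 1 <= b); [|lra].
      apply (Hb (b + 1)). intros x Hx. elim H. now exists x.
    + apply (Hb 0). intros x Hx. elim H. now exists x.
Qed.

(** * Averages over segments *)

(* The weight [1 - r] makes the derivative of this average along [c]
   equal to the mean of k over the segment minus its initial value. *)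
Definition segment_avg (k : R -> R -> R) (c1 c2 u v : R) : R :=
  RInt (fun r => (1 - r) * k (u + r * c1) (v + r * c2)) 0 1.

Lemma continuous_affine (a b t : R) : continuous (fun r => a + r * b) t.
Proof.
  apply (ex_derive_continuous (fun r => a + r * b)). auto_derive. auto.
Qed.

Lemma ex_RInt_segment (k : R -> R -> R) (c1 c2 u v : R) :
  continuous_2d k -> ex_RInt (fun r => (1 - r) * k (u + r * c1) (v + r * c2)) 0 1.
Proof.
  intros Hk. apply @ex_RInt_continuous. intros t _.
  apply (continuous_mult (fun r => 1 - r) (fun r => k (u + r * c1) (v + r * c2))).
  - apply (ex_derive_continuous (fun r => 1 - r)). auto_derive. auto.
  - apply continuous_2d_curve; auto; apply continuous_affine.
Qed.

(** Confines all segments with base points near a given one to a fixed box, on which uniform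
    continuity is available. The margin 1 is the reason for the radius [Rmin d 1] below. *)
Lemma Rabs_segment (c r d x y : R) :
  0 <= r <= 1 -> Rabs (y - x) < d -> d <= 1 ->
  x - 1 - Rabs c <= y + r * c <= x + 1 + Rabs c.
Proof.
  intros Hr Hy Hd. apply Rabs_def2 in Hy.
  assert (H : Rabs (r * c) <= Rabs c).
  { rewrite Rabs_mult, (Rabs_pos_eq r) by lra.
    pose proof (Rabs_pos c). nra. }
  apply Rabs_le_between in H. lra.
Qed.

Lemma continuous_2d_segment_avg (k : R -> R -> R) (c1 c2 : R) :
  continuous_2d k -> continuous_2d (segment_avg k c1 c2).
Proof.
  intros Hk x y eps.
  assert (He : 0 < eps / 2) by (pose proof (cond_pos eps); lra).
  destruct (uniform_continuity_2d k (x - 1 - Rabs c1) (x + 1 + Rabs c1)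
     (y - 1 - Rabs c2) (y + 1 + Rabs c2) (fun u v _ _ => Hk u v)
     (mkposreal _ He)) as [d Hd]. simpl in Hd.
  pose proof (cond_pos d) as Hd0.
  assert (Hm : 0 < Rmin d 1) by (apply Rmin_pos; lra).
  exists (mkposreal _ Hm). simpl. intros u v Hu Hv.
  pose proof (Rmin_l d 1). pose proof (Rmin_r d 1).
  unfold segment_avg. rewrite <- RInt_minus_R by (apply ex_RInt_segment; auto).
  eapply Rle_lt_trans; [apply (abs_RInt_le_const _ 0 1 (eps / 2))|].
  - lra.
  - apply @ex_RInt_minus; apply ex_RInt_segment; auto.
  - intros r Hr. rewrite <- Rmult_minus_distr_l, Rabs_mult, (Rabs_pos_eq (1 - r)) by lra.
    assert (Hx0 : Rabs (x - x) < Rmin d 1) by (rewrite Rminus_eq_0, Rabs_R0; lra).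
    assert (Hy0 : Rabs (y - y) < Rmin d 1) by (rewrite Rminus_eq_0, Rabs_R0; lra).
    assert (Hk' : Rabs (k (u + r * c1) (v + r * c2) - k (x + r * c1) (y + r * c2)) < eps / 2).
    { apply Hd; try (eapply Rabs_segment; eauto; fail).
      - replace (u + r * c1 - (x + r * c1)) with (u - x) by ring. lra.
      - replace (v + r * c2 - (y + r * c2)) with (v - y) by ring. lra. }
    pose proof (Rabs_pos (k (u + r * c1) (v + r * c2) - k (x + r * c1) (y + r * c2))).
    nra.
  - lra.
Qed.

Lemma C1_2d_segment_avg (k kx ky : R -> R -> R) (c1 c2 : R) :
  C1_2d k kx ky ->
  C1_2d (segment_avg k c1 c2) (segment_avg kx c1 c2) (segment_avg ky c1 c2).
Proof.
  intros Hk. pose proof (C1_2d_continuous _ _ _ Hk) as Ck.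
  pose proof Hk as (_ & _ & Hkx & Hky).
  assert (Aff : forall a b, continuous_2d (fun s r => s + r * a) /\
     continuous_2d (fun s r : R => b + r * a)).
  { intros a b. split;
    repeat first [apply continuous_2d_plus | apply continuous_2d_minus
      | apply continuous_2d_mult | apply continuous_2d_const
      | apply continuous_2d_fst | apply continuous_2d_snd]. }
  assert (W : continuous_2d (fun _ r => 1 - r)).
  { apply continuous_2d_minus; [apply continuous_2d_const | apply continuous_2d_snd]. }
  split; [|split; [|split; apply continuous_2d_segment_avg; auto]].
  - intros x y.
    apply (is_derive_RInt_param_C1 (fun s r => (1 - r) * k (s + r * c1) (y + r * c2))
      (fun s r => (1 - r) * kx (s + r * c1) (y + r * c2))).
    + intros s r.
      apply (is_derive_scal (fun z => k (z + r * c1) (y + r * c2))).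
      replace (kx (s + r * c1) (y + r * c2)) with
        (kx (s + r * c1) (y + r * c2) * 1 + ky (s + r * c1) (y + r * c2) * 0) by ring.
      apply (is_derive_curve k kx ky (fun z => z + r * c1) (fun z => y + r * c2)); auto;
        auto_derive; auto; ring.
    + apply continuous_2d_mult; auto. apply continuous_2d_comp; auto; now apply Aff.
    + apply continuous_2d_mult; auto. apply continuous_2d_comp; auto; now apply Aff.
  - intros x y.
    apply (is_derive_RInt_param_C1 (fun s r => (1 - r) * k (x + r * c1) (s + r * c2))
      (fun s r => (1 - r) * ky (x + r * c1) (s + r * c2))).
    + intros s r.
      apply (is_derive_scal (fun z => k (x + r * c1) (z + r * c2))).
      replace (ky (x + r * c1) (s + r * c2)) with
        (kx (x + r * c1) (s + r * c2) * 0 + ky (x + r * c1) (s + r * c2) * 1) by ring.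
      apply (is_derive_curve k kx ky (fun z => x + r * c1) (fun z => z + r * c2)); auto;
        auto_derive; auto; ring.
    + apply continuous_2d_mult; auto. apply continuous_2d_comp; auto; now apply Aff.
    + apply continuous_2d_mult; auto. apply continuous_2d_comp; auto; now apply Aff.
Qed.

(** Integration by parts along the segment: the derivative of [k] in direction [c] is its derivative
    in [r], and the weight [1 - r] kills the boundary term at [r = 1] and leaves [- k u v] at
    [r = 0]. *)
Lemma segment_avg_directional (k kx ky : R -> R -> R) (c1 c2 u v : R) :
  C1_2d k kx ky ->
  c1 * segment_avg kx c1 c2 u v + c2 * segment_avg ky c1 c2 u v =
  RInt (fun r => k (u + r * c1) (v + r * c2)) 0 1 - k u v.
Proof.
  intros Hk. pose proof (C1_2d_continuous _ _ _ Hk) as Ck.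
  pose proof Hk as (_ & _ & Hkx & Hky).
  unfold segment_avg.
  rewrite <- !RInt_scal_R by now apply ex_RInt_segment.
  rewrite <- RInt_plus_R by (apply @ex_RInt_scal; now apply ex_RInt_segment).
  assert (Cc : forall j, continuous_2d j ->
     forall t, continuous (fun r => j (u + r * c1) (v + r * c2)) t).
  { intros j Hj t. apply continuous_2d_curve; auto; apply continuous_affine. }
  set (dk r := kx (u + r * c1) (v + r * c2) * c1 + ky (u + r * c1) (v + r * c2) * c2).
  assert (I : - k u v =
    RInt (fun r => - 1 * k (u + r * c1) (v + r * c2) + (1 - r) * dk r) 0 1).
  { rewrite (RInt_of_is_derive (fun r => (1 - r) * k (u + r * c1) (v + r * c2))).
    - rewrite !Rmult_0_l, !Rplus_0_r. ring.
    - intros r. apply (is_derive_mult_R (fun r => 1 - r) (fun r => k (u + r * c1) (v + r * c2))).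
      + auto_derive; auto; ring.
      + apply (is_derive_curve k kx ky (fun z => u + z * c1) (fun z => v + z * c2)); auto;
        auto_derive; auto; ring.
    - intros r. unfold dk.
      apply (continuous_plus (fun r => - 1 * k (u + r * c1) (v + r * c2))
         (fun r => (1 - r) * (kx (u + r * c1) (v + r * c2) * c1 +
            ky (u + r * c1) (v + r * c2) * c2))).
      + apply (continuous_scal_r (-1) (fun r => k (u + r * c1) (v + r * c2))). auto.
      + apply (continuous_mult (fun r => 1 - r)
          (fun r => kx (u + r * c1) (v + r * c2) * c1 + ky (u + r * c1) (v + r * c2) * c2)).
        * apply (ex_derive_continuous (fun r => 1 - r)). auto_derive. auto.
        * apply (continuous_plus (fun r => kx (u + r * c1) (v + r * c2) * c1)
            (fun r => ky (u + r * c1) (v + r * c2) * c2));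
          [apply (continuous_mult (fun r => kx (u + r * c1) (v + r * c2)) (fun _ => c1))
          |apply (continuous_mult (fun r => ky (u + r * c1) (v + r * c2)) (fun _ => c2))];
          auto; apply continuous_const. }
  assert (Ek : ex_RInt (fun r => k (u + r * c1) (v + r * c2)) 0 1).
  { apply @ex_RInt_continuous. auto. }
  assert (I2 : RInt (fun r => c1 * ((1 - r) * kx (u + r * c1) (v + r * c2)) +
         c2 * ((1 - r) * ky (u + r * c1) (v + r * c2))) 0 1 =
         RInt (fun r => - 1 * k (u + r * c1) (v + r * c2) + (1 - r) * dk r) 0 1
          + RInt (fun r => k (u + r * c1) (v + r * c2)) 0 1).
  { rewrite <- RInt_plus_R; auto.
    - apply RInt_ext_R. intros r. unfold dk. ring.
    - apply @ex_RInt_plus.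
      + apply (ex_RInt_scal (fun r => k (u + r * c1) (v + r * c2))). auto.
      + apply (ex_RInt_ext (fun r => c1 * ((1 - r) * kx (u + r * c1) (v + r * c2)) +
         c2 * ((1 - r) * ky (u + r * c1) (v + r * c2)))).
        * intros r _. unfold dk. simpl; ring.
        * apply @ex_RInt_plus; apply @ex_RInt_scal; now apply ex_RInt_segment. }
  rewrite I2, <- I. ring.
Qed.

(** * Loops with a nonzero winding number *)

(** The retraction of the line onto the unit interval. It extends a homotopy given on the closed
    square to the whole plane, where two-sided continuity makes sense at every point. *)
Definition clamp (x : R) : R := Rmax 0 (Rmin 1 x).

Lemma clamp_range (x : R) : 0 <= clamp x <= 1.
Proof.
  unfold clamp. split; [apply Rmax_l|].
  apply Rmax_lub; [lra|apply Rmin_l].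
Qed.

Lemma clamp_id (x : R) : 0 <= x <= 1 -> clamp x = x.
Proof.
  intros H. unfold clamp. rewrite Rmin_right, Rmax_right; lra.
Qed.

Lemma clamp_lipschitz (x y : R) : Rabs (clamp x - clamp y) <= Rabs (x - y).
Proof.
  unfold clamp, Rmax, Rmin.
  repeat destruct Rle_dec; unfold Rabs; repeat destruct Rcase_abs; lra.
Qed.

Lemma continuous_on_clamp (G : R * R -> C) :
  continuous_on unit_square G ->
  continuous_2d (fun s t => fst (G (clamp s, clamp t))) /\
  continuous_2d (fun s t => snd (G (clamp s, clamp t))).
Proof.
  intros HG.
  assert (H : forall s t, filterlim (fun z : R * R => G (clamp (fst z), clamp (snd z)))
     (locally (s, t)) (locally (G (clamp s, clamp t)))).
  { intros s t. eapply filterlim_comp; [|apply HG].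
    2:{ split; simpl; apply clamp_range. }
    intros P [d Hd]. exists d. intros [u v] [Hu Hv].
    apply Hd.
    - split; simpl; eapply Rle_lt_trans;
        [apply clamp_lipschitz | exact Hu | apply clamp_lipschitz | exact Hv].
    - split; simpl; apply clamp_range. }
  split; intros s t; apply continuity_2d_pt_filterlim.
  - apply (filterlim_comp _ _ _ _ (fun z : C => fst z) _ _ _ (H s t)).
    apply (continuous_fst (fst (G (clamp s, clamp t))) (snd (G (clamp s, clamp t)))).
  - apply (filterlim_comp _ _ _ _ (fun z : C => snd z) _ _ _ (H s t)).
    apply (continuous_snd (fst (G (clamp s, clamp t))) (snd (G (clamp s, clamp t)))).
Qed.

(** On the open right half of the unit circle the angle is [atan] of the slope, since a positive
    cosine is determined by the tangent. This continuous formula replaces a general lifting of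
    paths. *)
Lemma cos_sin_atan_div (X Y : R) :
  0 < X -> X ^ 2 + Y ^ 2 = 1 -> cos (atan (Y / X)) = X /\ sin (atan (Y / X)) = Y.
Proof.
  intros HX H.
  destruct (atan_bound (Y / X)) as [B1 B2].
  assert (Hc : 0 < cos (atan (Y / X))) by (apply cos_gt_0; lra).
  pose proof (tan_atan (Y / X)) as Ht. unfold tan in Ht.
  pose proof (sin2_cos2 (atan (Y / X))) as Hsc. unfold Rsqr in Hsc.
  set (c := cos (atan (Y / X))) in *. set (s := sin (atan (Y / X))) in *.
  assert (Hs : s * X = Y * c).
  { replace s with (s / c * c) by (field; lra). rewrite Ht. field. lra. }
  assert (Hc2 : (c - X) * (c + X) = 0).
  { assert (c * c * (X ^ 2 + Y ^ 2) = X ^ 2 * (s * s + c * c)).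
    { transitivity (c * c * X ^ 2 + (Y * c) * (Y * c)); [ring|].
      rewrite <- Hs. ring. }
    rewrite H, Hsc in *. lra. }
  assert (c = X).
  { apply Rmult_integral in Hc2. destruct Hc2; lra. }
  split; auto. apply (Rmult_eq_reg_r X); [|lra]. rewrite Hs. subst c. now rewrite H0.
Qed.

Lemma continuity_sum_f_R0 (F : nat -> R -> R) (m : nat) :
  (forall i, continuity (F i)) -> continuity (fun s => sum_f_R0 (fun i => F i s) m).
Proof.
  intros H. induction m as [|m IH]; simpl; auto.
  apply (continuity_plus (fun s => sum_f_R0 (fun i => F i s) m) (F (S m))); auto.
Qed.

(* The lifted angle increments over a fine partition of the loops [t |-> G (s, t)]
   add up to
   a continuous function of [s] with values in [2 PI Z]; it vanishes at the
   constant end and equals [2 PI n] at the other. *)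
Lemma circle_winding_not_nullhomotopic (G : R * R -> C) (c : R -> R) (n : Z) (p : C) :
  continuous_on unit_square G ->
  (forall q, unit_square q -> Cmod (G q) = 1) ->
  (forall t, continuity_pt c t) -> c 1 = c 0 + IZR n -> n <> 0%Z ->
  (forall t, 0 <= t <= 1 -> G (0, t) = circle (c t)) ->
  (forall t, 0 <= t <= 1 -> G (1, t) = p) ->
  (forall s, 0 <= s <= 1 -> G (s, 0) = G (s, 1)) -> False.
Proof.
  intros HG H1 Hc Hcn Hn G0 G1 Gl.
  destruct (continuous_on_clamp G HG) as [Ca Cb].
  set (a s t := fst (G (clamp s, clamp t))) in *.
  set (b s t := snd (G (clamp s, clamp t))) in *.
  assert (Hunit : forall s t, a s t ^ 2 + b s t ^ 2 = 1).
  { intros s t. specialize (H1 (clamp s, clamp t)).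
    unfold Cmod in H1. fold (a s t) (b s t) in H1.
    rewrite <- (pow2_sqrt (a s t ^ 2 + b s t ^ 2)) by nra.
    rewrite H1; [ring|]. split; simpl; apply clamp_range. }
  (* Since [h] depends only on the clamped arguments, uniform continuity on the unit square gives
     one modulus for all [s] and [t], hence one partition that serves every loop of the homotopy. *)
  assert (U : forall h : R -> R -> R, continuous_2d h ->
     (forall s t, h s t = h (clamp s) (clamp t)) ->
     exists d : posreal, forall s t t', Rabs (t' - t) < d -> Rabs (h s t' - h s t) < 1 / 4).
  { intros h Hh Hcl.
    assert (E4 : 0 < 1 / 4) by lra.
    destruct (uniform_continuity_2d h 0 1 0 1 (fun u v _ _ => Hh u v) (mkposreal _ E4))
      as [d Hd]. simpl in Hd.
    exists d. intros s t t' Ht. rewrite (Hcl s t'), (Hcl s t).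
    apply Hd; try apply clamp_range.
    - rewrite Rminus_eq_0, Rabs_R0. apply cond_pos.
    - eapply Rle_lt_trans; [apply clamp_lipschitz|auto]. }
  assert (CC : forall x, clamp (clamp x) = clamp x).
  { intros x. apply clamp_id, clamp_range. }
  destruct (U a Ca) as [da Hda]. { intros; unfold a; now rewrite !CC. }
  destruct (U b Cb) as [db Hdb]. { intros; unfold b; now rewrite !CC. }
  assert (E4 : 0 < 1 / 4) by lra.
  destruct (Heine_cor2 (f := c) (a := 0) (b := 1) (fun x _ => Hc x) (mkposreal _ E4))
    as [dc Hdc]. simpl in Hdc.
  assert (Hd : 0 < Rmin da (Rmin db dc)).
  { repeat apply Rmin_pos; apply cond_pos. }
  destruct (archimed_cor1 _ Hd) as [N [HN HN0]].
  pose proof (Rmin_l da (Rmin db dc)). pose proof (Rmin_r da (Rmin db dc)).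
  pose proof (Rmin_l db dc). pose proof (Rmin_r db dc).
  assert (HN1 : 0 < INR N) by now apply lt_0_INR.
  set (t i := INR i / INR N).
  assert (Ht : forall i, Rabs (t (S i) - t i) = / INR N).
  { intros i. unfold t. rewrite S_INR.
    replace ((INR i + 1) / INR N - INR i / INR N) with (/ INR N) by (field; lra).
    apply Rabs_pos_eq. left. now apply Rinv_0_lt_compat. }
  (* [X] and [Y] are the cosine and sine of the angle from [G (s, t i)] to [G (s, t (S i))]. *)
  set (X i s := a s (t i) * a s (t (S i)) + b s (t i) * b s (t (S i))).
  set (Y i s := a s (t i) * b s (t (S i)) - b s (t i) * a s (t (S i))).
  assert (HX : forall i s, 0 < X i s).
  { intros i s. unfold X.
    pose proof (Hda s (t i) (t (S i))) as Ha. rewrite Ht in Ha.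
    pose proof (Hdb s (t i) (t (S i))) as Hb. rewrite Ht in Hb.
    specialize (Ha ltac:(lra)). specialize (Hb ltac:(lra)).
    apply Rabs_def2 in Ha. apply Rabs_def2 in Hb.
    pose proof (Hunit s (t i)). pose proof (Hunit s (t (S i))).
    nra. }
  assert (HXY : forall i s, X i s ^ 2 + Y i s ^ 2 = 1).
  { intros i s. unfold X, Y.
    transitivity ((a s (t i) ^ 2 + b s (t i) ^ 2) * (a s (t (S i)) ^ 2 + b s (t (S i)) ^ 2)).
    ring. rewrite !Hunit. ring. }
  set (th i s := atan (Y i s / X i s)).
  assert (Hrot : forall s m,
     a s (t (S m)) = a s 0 * cos (sum_f_R0 (fun i => th i s) m)
                     - b s 0 * sin (sum_f_R0 (fun i => th i s) m) /\
     b s (t (S m)) = a s 0 * sin (sum_f_R0 (fun i => th i s) m)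
                     + b s 0 * cos (sum_f_R0 (fun i => th i s) m)).
  { assert (Hstep : forall s i,
      a s (t (S i)) = a s (t i) * cos (th i s) - b s (t i) * sin (th i s) /\
      b s (t (S i)) = a s (t i) * sin (th i s) + b s (t i) * cos (th i s)).
    { intros s i. unfold th.
      destruct (cos_sin_atan_div _ _ (HX i s) (HXY i s)) as [-> ->].
      pose proof (Hunit s (t i)) as E. unfold X, Y.
      split.
      - transitivity (a s (t (S i)) * (a s (t i) ^ 2 + b s (t i) ^ 2)); [rewrite E|]; ring.
      - transitivity (b s (t (S i)) * (a s (t i) ^ 2 + b s (t i) ^ 2)); [rewrite E|]; ring. }
    assert (t0 : t 0%nat = 0) by (unfold t; change (INR 0) with 0; field; lra).
    intros s m. induction m as [|m [IH1 IH2]].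
    - simpl sum_f_R0. destruct (Hstep s 0%nat) as [A B]. rewrite t0 in A, B. auto.
    - destruct (Hstep s (S m)) as [A B]. simpl sum_f_R0.
      rewrite A, B, cos_plus, sin_plus, IH1, IH2. split; ring. }
  (* [sum_f_R0] up to [M] has [S M] terms, one for each interval of the partition. *)
  destruct N as [|M]; [simpl in HN1; lra|].
  set (Th s := sum_f_R0 (fun i => th i s) M).
  assert (tN : t (S M) = 1) by (unfold t; field; lra).
  (* Each loop closes up, so the rotation by the total angle fixes a unit vector and is the
     identity. *)
  assert (Hcos : forall s, cos (Th s) = 1).
  { intros s. destruct (Hrot s M) as [A B]. fold (Th s) in A, B. rewrite tN in A, B.
    assert (El : a s 0 = a s 1 /\ b s 0 = b s 1).
    { unfold a, b. rewrite (clamp_id 0), (clamp_id 1) by lra.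
      now rewrite (Gl (clamp s)) by apply clamp_range. }
    destruct El as [El1 El2]. rewrite <- El1 in A. rewrite <- El2 in B.
    pose proof (Hunit s 0) as E.
    transitivity ((a s 0 ^ 2 + b s 0 ^ 2) * cos (Th s)); [rewrite E; ring|].
    transitivity (a s 0 * (a s 0 * cos (Th s) - b s 0 * sin (Th s))
      + b s 0 * (a s 0 * sin (Th s) + b s 0 * cos (Th s))); [ring|].
    rewrite <- A, <- B, <- E. ring. }
  assert (HTc : continuity Th).
  { apply continuity_sum_f_R0. intros i s. unfold th.
    apply (continuity_pt_comp (fun s => Y i s / X i s) atan).
    - assert (Sl : forall h, continuous_2d h -> forall r, continuity_pt (fun s => h s r) s).
      { intros h Hh r. apply continuity_pt_filterlim. now apply (continuous_2d_slice_l h). }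
      apply (continuity_pt_div (Y i) (X i)).
      + apply (continuity_pt_minus (fun s => a s (t i) * b s (t (S i)))
          (fun s => b s (t i) * a s (t (S i)))).
        * apply (continuity_pt_mult (fun s => a s (t i)) (fun s => b s (t (S i)))); auto.
        * apply (continuity_pt_mult (fun s => b s (t i)) (fun s => a s (t (S i)))); auto.
      + apply (continuity_pt_plus (fun s => a s (t i) * a s (t (S i)))
          (fun s => b s (t i) * b s (t (S i)))).
        * apply (continuity_pt_mult (fun s => a s (t i)) (fun s => a s (t (S i)))); auto.
        * apply (continuity_pt_mult (fun s => b s (t i)) (fun s => b s (t (S i)))); auto.
      + pose proof (HX i s). lra.
    - apply continuity_pt_filterlim, continuous_atan. }
  assert (HT1 : Th 1 = 0).
  { apply sum_eq_R0. intros i Hi. unfold th, Y.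
    unfold a, b. rewrite (clamp_id 1), !G1 by (try apply clamp_range; lra).
    rewrite <- atan_0. f_equal. unfold Rdiv. ring. }
  assert (HT0 : Th 0 = 2 * PI * IZR n).
  { assert (Hin : forall i, (i <= S M)%nat -> 0 <= t i <= 1).
    { intros i Hi. unfold t. apply le_INR in Hi. pose proof (pos_INR i).
      split.
      - apply Rmult_le_pos; auto. left. now apply Rinv_0_lt_compat.
      - apply (Rmult_le_reg_r (INR (S M))); auto.
        unfold Rdiv. rewrite Rmult_assoc, Rinv_l by lra. lra. }
    assert (Hth : forall i, (i <= M)%nat -> th i 0 = 2 * PI * (c (t (S i)) - c (t i))).
    { intros i Hi. unfold th.
      set (D := 2 * PI * (c (t (S i)) - c (t i))).
      assert (Ia := Hin i ltac:(lia)). assert (Ib := Hin (S i) ltac:(lia)).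
      assert (X i 0 = cos D /\ Y i 0 = sin D) as [-> ->].
      { unfold X, Y, a, b. rewrite (clamp_id 0) by lra.
        rewrite (clamp_id (t i)), (clamp_id (t (S i))) by auto.
        rewrite !G0 by auto. unfold circle; simpl fst; simpl snd.
        unfold D. rewrite Rmult_minus_distr_l, cos_minus, sin_minus. split; ring. }
      (* An increment of [c] below 1/4 keeps [D] strictly between [- PI / 2] and [PI / 2], where
         [atan] inverts [tan]. *)
      apply atan_tan. unfold D.
      pose proof (Hdc (t (S i)) (t i) Ib Ia) as Hdd. rewrite Ht in Hdd.
      specialize (Hdd ltac:(lra)). apply Rabs_def2 in Hdd.
      pose proof PI_RGT_0. nra. }
    assert (Hsum : forall m, (m <= M)%nat ->
      sum_f_R0 (fun i => th i 0) m = 2 * PI * (c (t (S m)) - c (t 0%nat))).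
    { induction m as [|m IH]; intros Hm; simpl sum_f_R0.
      - now apply Hth.
      - rewrite IH, Hth by lia. ring. }
    unfold Th. rewrite Hsum by lia. rewrite tN, Hcn.
    replace (t 0%nat) with 0 by (unfold t; change (INR 0) with 0; field; lra). ring. }
  pose proof PI_RGT_0 as HPI.
  (* Between the values [2 PI n] and 0 the continuous [Th] must take the value [PI] or [- PI],
     according to the sign of [n]; there the cosine is -1, not 1. *)
  assert (Hpi : exists s, Th s = PI \/ Th s = - PI).
  { destruct (Z_lt_le_dec 0 n) as [Hp|Hp].
    - assert (1 <= IZR n) by (apply IZR_le; lia).
      destruct (IVT_gen Th 0 1 PI HTc) as [s [_ Hs]]; [|eauto].
      rewrite HT0, HT1. rewrite Rmin_right, Rmax_left by nra. nra.
    - assert (IZR n <= -1) by (apply IZR_le; lia).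
      destruct (IVT_gen Th 0 1 (- PI) HTc) as [s [_ Hs]]; [|eauto].
      rewrite HT0, HT1. rewrite Rmin_left, Rmax_right by nra. nra. }
  destruct Hpi as [s [Hs|Hs]]; pose proof (Hcos s) as E; rewrite Hs in E.
  - rewrite cos_PI in E. lra.
  - rewrite cos_neg, cos_PI in E. lra.
Qed.

(** A contraction of the loop projects to a contraction in each circle factor; the winding lemma
    applies in a factor whose winding number is nonzero. *)
Lemma not_contractible_proj (c : R -> R * R) (m n : Z) :
  (forall t, continuous (fun s => fst (c s)) t) ->
  (forall t, continuous (fun s => snd (c s)) t) ->
  fst (c 1) = fst (c 0) + IZR m -> snd (c 1) = snd (c 0) + IZR n ->
  (m, n) <> (0, 0)%Z -> ~ contractible (fun t => proj (c t)).
Proof.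
  intros C1c C2c E1 E2 Hmn (H & p & HC & HT & H0 & H1 & Hl).
  destruct (Z.eq_dec m 0) as [Hm|Hm]; [destruct (Z.eq_dec n 0) as [Hn|Hn]|].
  - apply Hmn. now rewrite Hm, Hn.
  - apply (circle_winding_not_nullhomotopic (fun q => snd (H q))
      (fun t => snd (c t)) n (snd p)); auto.
    + intros q Hq. eapply filterlim_comp; [apply (HC q Hq)|].
      apply (continuous_snd (fst (H q)) (snd (H q))).
    + intros q Hq. apply (HT q Hq).
    + intros t. apply continuity_pt_filterlim, C2c.
    + intros t Ht. now rewrite H0.
    + intros t Ht. now rewrite H1.
    + intros s Hs. now rewrite Hl.
  - apply (circle_winding_not_nullhomotopic (fun q => fst (H q))
      (fun t => fst (c t)) m (fst p)); auto.
    + intros q Hq. eapply filterlim_comp; [apply (HC q Hq)|].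
      apply (continuous_fst (fst (H q)) (snd (H q))).
    + intros q Hq. apply (HT q Hq).
    + intros t. apply continuity_pt_filterlim, C1c.
    + intros t Ht. now rewrite H0.
    + intros t Ht. now rewrite H1.
    + intros s Hs. now rewrite Hl.
Qed.

(** * The flat torus *)

Definition dx (h : R -> R -> R) (x y : R) : R := Derive (fun t => h t y) x.

Definition dy (h : R -> R -> R) (x y : R) : R := Derive (fun t => h x t) y.

Lemma smooth_dx (h : R -> R -> R) : smooth h -> smooth (dx h).
Proof. intros H n x y. apply (H (S n) x y). Qed.

Lemma smooth_dy (h : R -> R -> R) : smooth h -> smooth (dy h).
Proof. intros H n x y. apply (H (S n) x y). Qed.

Lemma smooth_continuous_2d (h : R -> R -> R) : smooth h -> continuous_2d h.
Proof. intros H x y. apply (H 0%nat x y). Qed.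

Lemma is_derive_dx (h : R -> R -> R) (x y : R) :
  smooth h -> is_derive (fun t => h t y) x (dx h x y).
Proof. intros H. apply Derive_correct, (H 1%nat x y). Qed.

Lemma is_derive_dy (h : R -> R -> R) (x y : R) :
  smooth h -> is_derive (fun t => h x t) y (dy h x y).
Proof. intros H. apply Derive_correct, (H 1%nat x y). Qed.

Lemma smooth_C1_2d (h : R -> R -> R) : smooth h -> C1_2d h (dx h) (dy h).
Proof.
  intros H. split; [|split; [|split]].
  - intros x y. now apply is_derive_dx.
  - intros x y. now apply is_derive_dy.
  - now apply smooth_continuous_2d, smooth_dx.
  - now apply smooth_continuous_2d, smooth_dy.
Qed.

Lemma smooth_Schwarz (h : R -> R -> R) (x y : R) :
  smooth h -> dx (dy h) x y = dy (dx h) x y.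
Proof.
  intros H. pose proof (smooth_dx _ H) as Hx. pose proof (smooth_dy _ H) as Hy.
  apply (Schwarz h).
  - exists (mkposreal 1 Rlt_0_1). intros u v _ _.
    repeat split; [apply (H 1%nat u v) | apply (H 1%nat u v)
      | apply (Hy 1%nat u v) | apply (Hx 1%nat u v)].
  - apply (smooth_continuous_2d _ (smooth_dx _ Hy)).
  - apply (smooth_continuous_2d _ (smooth_dy _ Hx)).
Qed.

(** A change of sign would produce a zero on a segment from the origin. This serves to replace the
    absolute value of the Jacobian, which is not a divergence, by a constant multiple of the
    Jacobian. *)
Lemma constant_sign (h : R -> R -> R) :
  continuous_2d h -> (forall x y, h x y <> 0) ->
  exists e, Rabs e = 1 /\ forall x y, Rabs (h x y) = e * h x y.
Proof.
  intros Hh Hn.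
  assert (P : forall x y, 0 < h 0 0 * h x y).
  { intros x y. apply Rnot_le_lt. intros Hle.
    destruct (IVT_gen (fun s => h (s * x) (s * y)) 0 1 0) as [s [_ Hs]].
    - intros s. apply continuity_pt_filterlim.
      apply (continuous_2d_curve h (fun s => s * x) (fun s => s * y)); auto;
        [apply (ex_derive_continuous (fun s => s * x))
        |apply (ex_derive_continuous (fun s => s * y))]; auto_derive; auto.
    - rewrite !Rmult_0_l, !Rmult_1_l.
      pose proof (Hn 0 0). pose proof (Hn x y).
      destruct (Rle_lt_dec (h 0 0) 0).
      + assert (0 <= h x y) by nra. rewrite Rmin_left, Rmax_right; lra.
      + assert (h x y <= 0) by nra. rewrite Rmin_right, Rmax_left; lra.
    - exact (Hn _ _ Hs). }
  destruct (Rle_lt_dec (h 0 0) 0) as [H0|H0].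
  - exists (-1). split; [rewrite Rabs_left; lra|]. intros x y.
    pose proof (P x y). rewrite Rabs_left by nra. ring.
  - exists 1. split; [apply Rabs_R1|]. intros x y.
    pose proof (P x y). rewrite Rabs_pos_eq by nra. ring.
Qed.

Definition jac (Phi : R -> R -> R * R) (x y : R) : R :=
  dx (fun s t => fst (Phi s t)) x y * dy (fun s t => snd (Phi s t)) x y
  - dy (fun s t => fst (Phi s t)) x y * dx (fun s t => snd (Phi s t)) x y.

Lemma metric_det_pos (g : metric) (x y : R) : 0 < gE g x y * gG g x y - gF g x y ^ 2.
Proof.
  assert (HE : 0 < gE g x y).
  { pose proof (metric_pos g x y 1 0 ltac:(intros H; injection H; lra)). lra. }
  (* On the vector [(- F, E)] the form takes the value [E (E G - F^2)]. *)
  pose proof (metric_pos g x y (- gF g x y) (gE g x y)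
    ltac:(intros H; injection H; lra)) as H.
  apply (Rmult_lt_reg_l (gE g x y)); auto. nra.
Qed.

Lemma area_density_pos (g : metric) (x y : R) : 0 < area_density g x y.
Proof. apply sqrt_lt_R0, metric_det_pos. Qed.

(** Lagrange's identity: the Gram determinant of the two partial derivatives of [Phi] is the square
    of the Jacobian. *)
Lemma area_density_pullback (g0 : metric) (Phi : R -> R -> R * R) (x y : R) :
  euclidean_pullback g0 Phi -> area_density g0 x y = Rabs (jac Phi x y).
Proof.
  intros H. destruct (H x y) as (HE & HF & HG).
  unfold area_density. rewrite <- sqrt_Rsqr_abs. f_equal.
  rewrite HE, HF, HG. unfold Rsqr, jac, dx, dy. ring.
Qed.

Lemma continuous_2d_jac (Phi : R -> R -> R * R) :
  smooth_map Phi -> continuous_2d (jac Phi).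
Proof.
  intros [Hu Hv]. apply continuous_2d_minus; apply continuous_2d_mult;
    apply smooth_continuous_2d; first [now apply smooth_dx | now apply smooth_dy].
Qed.

Lemma jac_constant_sign (g0 : metric) (Phi : R -> R -> R * R) :
  smooth_map Phi -> euclidean_pullback g0 Phi ->
  exists e, Rabs e = 1 /\ forall x y, area_density g0 x y = e * jac Phi x y.
Proof.
  intros Hs Hp. destruct (constant_sign (jac Phi)) as [e [He1 He]].
  - now apply continuous_2d_jac.
  - intros x y E. pose proof (area_density_pos g0 x y) as P.
    rewrite (area_density_pullback g0 Phi) in P by auto.
    rewrite E, Rabs_R0 in P. lra.
  - exists e. split; auto. intros x y. rewrite <- He. now apply area_density_pullback.
Qed.

Lemma continuous_2d_area_density (g0 : metric) (Phi : R -> R -> R * R) :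
  smooth_map Phi -> euclidean_pullback g0 Phi -> continuous_2d (area_density g0).
Proof.
  intros Hs Hp. apply (continuous_2d_ext (fun x y => Rabs (jac Phi x y))).
  - intros. symmetry. now apply area_density_pullback.
  - now apply continuous_2d_abs, continuous_2d_jac.
Qed.

Definition quasi_periodic (Phi : R -> R -> R * R) (w1 w2 : R * R) : Prop :=
  deck_translation Phi 1 0 w1 /\ deck_translation Phi 0 1 w2.

Lemma quasi_periodic_fst (Phi : R -> R -> R * R) (w1 w2 : R * R) (x y : R) :
  quasi_periodic Phi w1 w2 ->
  fst (Phi (x + 1) y) = fst (Phi x y) + fst w1 /\
  fst (Phi x (y + 1)) = fst (Phi x y) + fst w2.
Proof.
  intros [H1 H2]. specialize (H1 x y). specialize (H2 x y).
  rewrite Rplus_0_r in H1, H2. rewrite H1, H2. split; reflexivity.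
Qed.

Lemma quasi_periodic_snd (Phi : R -> R -> R * R) (w1 w2 : R * R) (x y : R) :
  quasi_periodic Phi w1 w2 ->
  snd (Phi (x + 1) y) = snd (Phi x y) + snd w1 /\
  snd (Phi x (y + 1)) = snd (Phi x y) + snd w2.
Proof.
  intros [H1 H2]. specialize (H1 x y). specialize (H2 x y).
  rewrite Rplus_0_r in H1, H2. rewrite H1, H2. split; reflexivity.
Qed.

(** The right-hand side is the signed area of the parallelogram on [w1] and [w2]; this ties the area
    of the torus to the coarea of its deck lattice. *)
Lemma square_int_jac (Phi : R -> R -> R * R) (w1 w2 : R * R) :
  smooth_map Phi -> quasi_periodic Phi w1 w2 ->
  square_int (jac Phi) = fst w1 * snd w2 - fst w2 * snd w1.
Proof.
  intros [Hu Hv] Hq.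
  apply (jacobian_integral (fun x y => fst (Phi x y)) _ _ (fun x y => snd (Phi x y)) _ _
    (dy (dx (fun x y => snd (Phi x y))))).
  - now apply smooth_C1_2d.
  - now apply smooth_C1_2d.
  - intros x y. rewrite <- smooth_Schwarz by auto.
    now apply (is_derive_dx (dy (fun x y => snd (Phi x y)))), smooth_dy.
  - intros x y. now apply (is_derive_dy (dx (fun x y => snd (Phi x y)))), smooth_dx.
  - now apply smooth_continuous_2d, smooth_dy, smooth_dx.
  - intros. now apply quasi_periodic_fst.
  - intros. now apply quasi_periodic_snd.
Qed.

(* Translations of the flat plane preserve area, so averaging over a segment
   does not change the integral over a fundamental domain. *)
Lemma square_int_segment_mean (Phi : R -> R -> R * R) (w1 w2 : R * R)
    (k kx ky : R -> R -> R) (c1 c2 : R) :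
  smooth_map Phi -> quasi_periodic Phi w1 w2 -> C1_2d k kx ky ->
  (forall u v, k (u + fst w1) (v + snd w1) = k u v) ->
  (forall u v, k (u + fst w2) (v + snd w2) = k u v) ->
  let A x y : R := RInt (fun r => k (fst (Phi x y) + r * c1) (snd (Phi x y) + r * c2)) 0 1 in
  continuous_2d A /\
  square_int (fun x y => A x y * jac Phi x y) =
  square_int (fun x y => k (fst (Phi x y)) (snd (Phi x y)) * jac Phi x y).
Proof.
  intros Hs Hq Hk K1 K2 A. pose proof Hs as [Hu Hv].
  set (u x y := fst (Phi x y)) in *. set (v x y := snd (Phi x y)) in *.
  assert (EA : forall x y, A x y = c1 * segment_avg kx c1 c2 (u x y) (v x y)
     + c2 * segment_avg ky c1 c2 (u x y) (v x y) + k (u x y) (v x y)).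
  { intros x y. 
    pose proof (segment_avg_directional k kx ky c1 c2 (u x y) (v x y) Hk) as D.
    change (RInt _ 0 1) with (A x y) in D. lra. }
  pose proof (C1_2d_continuous _ _ _ Hk) as Ck.
  pose proof (smooth_C1_2d _ Hu) as Hu1. pose proof (smooth_C1_2d _ Hv) as Hv1.
  pose proof (C1_2d_continuous _ _ _ Hu1) as Cu.
  pose proof (C1_2d_continuous _ _ _ Hv1) as Cv.
  pose proof (C1_2d_segment_avg k kx ky c1 c2 Hk) as HN.
  pose proof (C1_2d_comp _ _ _ _ _ _ _ _ _ HN Hu1 Hv1) as Hh.
  pose proof (continuous_2d_jac _ Hs) as CJ.
  assert (CA : continuous_2d A).
  { eapply continuous_2d_ext; [intros; symmetry; apply EA|].
    destruct HN as (_ & _ & HN1 & HN2).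
    repeat apply continuous_2d_plus; [apply continuous_2d_mult..|];
      try apply continuous_2d_const; apply continuous_2d_comp; auto. }
  split; auto.
  (* [ts] is the linear coordinate constant in direction [c]. For any [N], the Jacobian of [N]
     composed with [Phi] against [ts] is the derivative of [N] along [c], taken at [Phi], times
     [jac Phi]. *)
  set (ts x y := v x y * c1 + u x y * (- c2)).
  assert (Hts : forall a b : R -> R, forall x a' b', is_derive a x a' -> is_derive b x b' ->
     is_derive (fun s => b s * c1 + a s * (- c2)) x (b' * c1 + a' * (- c2))).
  { intros a b x a' b' Ha Hb.
    apply (is_derive_plus (fun s => b s * c1) (fun s => a s * (- c2)));
      apply (is_derive_scal_l (V := R_NormedModule)); auto. }
  assert (Z : square_int (fun x y => (A x y - k (u x y) (v x y)) * jac Phi x y) = 0).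
  { rewrite (square_int_ext _ (fun x y =>
      (segment_avg kx c1 c2 (u x y) (v x y) * dx u x y +
       segment_avg ky c1 c2 (u x y) (v x y) * dx v x y) *
      (dy v x y * c1 + dy u x y * (- c2)) -
      (segment_avg kx c1 c2 (u x y) (v x y) * dy u x y +
       segment_avg ky c1 c2 (u x y) (v x y) * dy v x y) *
      (dx v x y * c1 + dx u x y * (- c2)))).
    2:{ intros x y. rewrite EA. unfold jac. fold u v. ring. }
    assert (Cl : forall a b, continuous_2d a -> continuous_2d b ->
       continuous_2d (fun x y => b x y * c1 + a x y * (- c2))).
    { intros a b Ha Hb. apply continuous_2d_plus; apply continuous_2d_mult;
        auto; apply continuous_2d_const. }
    (* The segment average inherits the periods of [k], so its quasi-periods are 0 and so is the
       integral. *)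
    rewrite (jacobian_integral (fun x y => segment_avg k c1 c2 (u x y) (v x y)) _ _
      ts _ _ (fun x y => dy (dx v) x y * c1 + dy (dx u) x y * (- c2))
      0 0 (snd w1 * c1 + fst w1 * (- c2)) (snd w2 * c1 + fst w2 * (- c2))); auto.
    - ring.
    - destruct Hu1 as (U1 & U2 & U3 & U4). destruct Hv1 as (V1 & V2 & V3 & V4).
      split; [|split; [|split]]; auto.
      + intros x y. apply (Hts (fun s => u s y) (fun s => v s y)); auto.
      + intros x y. apply (Hts (fun s => u x s) (fun s => v x s)); auto.
    - intros x y. apply (Hts (fun s => dy u s y) (fun s => dy v s y));
        rewrite <- smooth_Schwarz by auto;
        [now apply (is_derive_dx (dy u)), smooth_dy | now apply (is_derive_dx (dy v)), smooth_dy].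
    - intros x y. apply (Hts (fun s => dx u x s) (fun s => dx v x s));
        [now apply (is_derive_dy (dx u)), smooth_dx | now apply (is_derive_dy (dx v)), smooth_dx].
    - apply Cl; now apply smooth_continuous_2d, smooth_dy, smooth_dx.
    - intros x y.
      destruct (quasi_periodic_fst Phi w1 w2 x y Hq) as [F1 F2].
      destruct (quasi_periodic_snd Phi w1 w2 x y Hq) as [S1 S2].
      rewrite !Rplus_0_r. unfold u, v, segment_avg. rewrite F1, F2, S1, S2.
      split; apply RInt_ext_R; intros r.
      + rewrite <- (K1 (fst (Phi x y) + r * c1)). f_equal. f_equal; ring.
      + rewrite <- (K2 (fst (Phi x y) + r * c1)). f_equal. f_equal; ring.
    - intros x y.
      destruct (quasi_periodic_fst Phi w1 w2 x y Hq) as [F1 F2].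
      destruct (quasi_periodic_snd Phi w1 w2 x y Hq) as [S1 S2].
      unfold ts, u, v. rewrite F1, F2, S1, S2. split; ring. }
  rewrite (square_int_ext _ (fun x y => (A x y - k (u x y) (v x y)) * jac Phi x y
     + k (u x y) (v x y) * jac Phi x y)) by (intros; ring).
  assert (CkPhi : continuous_2d (fun x y => k (u x y) (v x y)))
    by now apply continuous_2d_comp.
  rewrite square_int_plus, Z.
  - unfold u, v. ring.
  - apply continuous_2d_mult; auto. now apply continuous_2d_minus.
  - now apply continuous_2d_mult.
Qed.

(** * Length of flat segments and the systole *)

Lemma sys_nonneg (g : metric) : 0 <= sys g.
Proof.
  unfold sys. set (S := fun l => exists c, noncontractible_loop c /\ l = length g c).
  destruct (Glb_Rbar_correct S) as [_ H].
  specialize (H 0). assert (Hb : is_lb_Rbar S 0).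
  { intros l [c [_ ->]]. apply RInt_nonneg. intros t. apply sqrt_pos. }
  (* The lower bound 0 excludes [m_infty], and [real] sends [p_infty] to 0. *)
  specialize (H Hb). destruct (Glb_Rbar S); simpl in *; lra.
Qed.

Lemma sys_le_length (g : metric) (c : R -> R * R) :
  noncontractible_loop c -> sys g <= length g c.
Proof.
  intros Hc. unfold sys. set (S := fun l => exists c, noncontractible_loop c /\ l = length g c).
  destruct (Glb_Rbar_correct S) as [H1 _].
  assert (Hl : S (length g c)) by now exists c.
  specialize (H1 _ Hl).
  (* Settles the case of an infimum [m_infty], which [real] also sends to 0. *)
  assert (0 <= length g c) by (apply RInt_nonneg; intros t; apply sqrt_pos).
  destruct (Glb_Rbar S); simpl in *; lra.
Qed.

Lemma circle_add_IZR (x : R) (n : Z) : circle (x + IZR n) = circle x.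
Proof.
  unfold circle. replace (2 * PI * (x + IZR n)) with (2 * PI * x + 2 * IZR n * PI) by ring.
  assert (Hs : sin (2 * IZR n * PI) = 0).
  { apply sin_eq_0_1. exists (2 * n)%Z. now rewrite mult_IZR. }
  assert (Hc : cos (2 * IZR n * PI) = 1).
  { replace (2 * IZR n * PI) with (2 * (IZR n * PI)) by ring.
    rewrite cos_2a_sin. rewrite (sin_eq_0_1 (IZR n * PI)) by (now exists n). ring. }
  rewrite cos_plus, sin_plus, Hs, Hc. f_equal; ring.
Qed.

Lemma deck_translation_inverse (Phi Psi : R -> R -> R * R) (m n : Z) (w : R * R) (u v : R) :
  (forall x y, Psi (fst (Phi x y)) (snd (Phi x y)) = (x, y)) ->
  (forall a b, Phi (fst (Psi a b)) (snd (Psi a b)) = (a, b)) ->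
  deck_translation Phi m n w ->
  Psi (u + fst w) (v + snd w) = (fst (Psi u v) + IZR m, snd (Psi u v) + IZR n).
Proof.
  intros H1 H2 H. rewrite <- H1. rewrite H, H2. reflexivity.
Qed.

Definition flat_segment (Psi : R -> R -> R * R) (u v c1 c2 : R) (t : R) : R * R :=
  Psi (u + t * c1) (v + t * c2).

Lemma is_derive_along_segment (h : R -> R -> R) (u v c1 c2 t : R) :
  smooth h ->
  is_derive (fun s => h (u + s * c1) (v + s * c2)) t
    (dx h (u + t * c1) (v + t * c2) * c1 + dy h (u + t * c1) (v + t * c2) * c2).
Proof.
  intros Hh. apply (is_derive_curve h (dx h) (dy h) (fun s => u + s * c1) (fun s => v + s * c2)).
  - now apply smooth_C1_2d.
  - auto_derive; auto; ring.
  - auto_derive; auto; ring.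
Qed.

Lemma C1_along_segment (h : R -> R -> R) (u v c1 c2 : R) :
  smooth h -> Defs.C1 (fun s => h (u + s * c1) (v + s * c2)).
Proof.
  intros Hh t. split.
  - eexists. now apply is_derive_along_segment.
  - apply (continuous_ext (fun t => dx h (u + t * c1) (v + t * c2) * c1
        + dy h (u + t * c1) (v + t * c2) * c2)).
    + intros s. symmetry. now apply is_derive_unique, is_derive_along_segment.
    + apply (continuous_2d_curve (fun a b => dx h a b * c1 + dy h a b * c2)
        (fun t => u + t * c1) (fun t => v + t * c2)); try apply continuous_affine.
      apply continuous_2d_plus; apply continuous_2d_mult; try apply continuous_2d_const;
        apply smooth_continuous_2d; [now apply smooth_dx | now apply smooth_dy].
Qed.

Lemma flat_segment_noncontractible (Phi Psi : R -> R -> R * R) (m n : Z) (w : R * R) (u v : R) :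
  smooth_map Psi ->
  (forall x y, Psi (fst (Phi x y)) (snd (Phi x y)) = (x, y)) ->
  (forall a b, Phi (fst (Psi a b)) (snd (Psi a b)) = (a, b)) ->
  deck_translation Phi m n w -> (m, n) <> (0, 0)%Z ->
  noncontractible_loop (flat_segment Psi u v (fst w) (snd w)).
Proof.
  intros [HP HQ] H1 H2 Hw Hmn.
  pose proof (C1_along_segment _ u v (fst w) (snd w) HP) as CP.
  pose proof (C1_along_segment _ u v (fst w) (snd w) HQ) as CQ.
  assert (E : flat_segment Psi u v (fst w) (snd w) 1 =
    (fst (flat_segment Psi u v (fst w) (snd w) 0) + IZR m,
     snd (flat_segment Psi u v (fst w) (snd w) 0) + IZR n)).
  { unfold flat_segment. rewrite !Rmult_1_l, !Rmult_0_l, !Rplus_0_r.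
    now apply (deck_translation_inverse Phi). }
  split; [|split].
  (* A single piece, with break points [INR 0] and [INR 1]. *)
  - exists 0%nat, INR. split; [reflexivity|split; [reflexivity|split]].
    + intros i Hi. rewrite S_INR. lra.
    + intros i Hi. exists (flat_segment Psi u v (fst w) (snd w)). auto.
  - rewrite E. unfold proj; simpl. now rewrite !circle_add_IZR.
  - apply (not_contractible_proj _ m n); try (now rewrite E); auto; intros t.
    + apply (ex_derive_continuous (fun s => fst (Psi (u + s * fst w) (v + s * snd w)))), CP.
    + apply (ex_derive_continuous (fun s => snd (Psi (u + s * fst w) (v + s * snd w)))), CQ.
Qed.

Lemma qform_pullback (g0 : metric) (Phi : R -> R -> R * R) (p d : R * R) :
  euclidean_pullback g0 Phi ->
  qform g0 p d =
  (dx (fun s t => fst (Phi s t)) (fst p) (snd p) * fst d +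
   dy (fun s t => fst (Phi s t)) (fst p) (snd p) * snd d) ^ 2 +
  (dx (fun s t => snd (Phi s t)) (fst p) (snd p) * fst d +
   dy (fun s t => snd (Phi s t)) (fst p) (snd p) * snd d) ^ 2.
Proof.
  intros H. destruct (H (fst p) (snd p)) as (HE & HF & HG).
  unfold qform. rewrite HE, HF, HG. unfold dx, dy. ring.
Qed.

(** The velocity enters [g0] only through its image under the differential of [Phi]. As [Phi]
    carries the curve to a straight segment, the chain rule gives [(c1, c2)] for that image, and the
    derivative of [Psi] is never computed. *)
Lemma length_flat_segment (g g0 : metric) (f : R -> R -> R)
    (Phi Psi : R -> R -> R * R) (u v c1 c2 : R) :
  smooth_map Phi -> smooth_map Psi ->
  (forall a b, Phi (fst (Psi a b)) (snd (Psi a b)) = (a, b)) ->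
  euclidean_pullback g0 Phi -> conformal_factor g g0 f ->
  length g (flat_segment Psi u v c1 c2) =
  sqrt (c1 ^ 2 + c2 ^ 2) * RInt (fun t => f (fst (Psi (u + t * c1) (v + t * c2)))
                                  (snd (Psi (u + t * c1) (v + t * c2)))) 0 1.
Proof.
  intros [HU HV] [HP HQ] Hinv Hp [[Hf _] Hc].
  set (gam t := flat_segment Psi u v c1 c2 t).
  assert (Dp : forall t, ex_derive (fun s => fst (gam s)) t)
    by (intros t; apply (C1_along_segment _ u v c1 c2 HP)).
  assert (Dq : forall t, ex_derive (fun s => snd (gam s)) t)
    by (intros t; apply (C1_along_segment _ u v c1 c2 HQ)).
  unfold length. rewrite <- RInt_scal_R.
  - apply RInt_ext_R. intros t. fold (gam t).
    set (d1 := Derive (fun s => fst (gam s)) t). set (d2 := Derive (fun s => snd (gam s)) t).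
    assert (D1 : is_derive (fun s => fst (gam s)) t d1) by now apply Derive_correct.
    assert (D2 : is_derive (fun s => snd (gam s)) t d2) by now apply Derive_correct.
    assert (Hq : qform g (gam t) (d1, d2) =
       f (fst (gam t)) (snd (gam t)) ^ 2 * (c1 ^ 2 + c2 ^ 2)).
    { transitivity (f (fst (gam t)) (snd (gam t)) ^ 2 * qform g0 (gam t) (d1, d2)).
      - destruct (Hc (fst (gam t)) (snd (gam t))) as (_ & E1 & E2 & E3).
        unfold qform. rewrite E1, E2, E3. ring.
      - f_equal. rewrite (qform_pullback g0 Phi) by auto. simpl fst; simpl snd.
        f_equal; f_equal.
        + pose proof (is_derive_curve _ _ _ _ _ t d1 d2 (smooth_C1_2d _ HU) D1 D2) as D.
          apply is_derive_unique in D. rewrite <- D.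
          rewrite (Derive_ext _ (fun s => u + s * c1)).
          * apply is_derive_unique. auto_derive; auto; ring.
          * intros s. unfold gam, flat_segment. now rewrite Hinv.
        + pose proof (is_derive_curve _ _ _ _ _ t d1 d2 (smooth_C1_2d _ HV) D1 D2) as D.
          apply is_derive_unique in D. rewrite <- D.
          rewrite (Derive_ext _ (fun s => v + s * c2)).
          * apply is_derive_unique. auto_derive; auto; ring.
          * intros s. unfold gam, flat_segment. now rewrite Hinv. }
    etransitivity; [apply f_equal, Hq|].
    destruct (Hc (fst (gam t)) (snd (gam t))) as (Hpos & _).
    rewrite sqrt_mult by nra. rewrite sqrt_pow2 by lra.
    unfold gam, flat_segment. ring.
  - apply @ex_RInt_continuous. intros t _.
    apply (continuous_2d_curve f (fun s => fst (gam s)) (fun s => snd (gam s))).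
    + now apply smooth_continuous_2d.
    + now apply (ex_derive_continuous (fun s => fst (gam s))).
    + now apply (ex_derive_continuous (fun s => snd (gam s))).
Qed.

(** Written in terms of [c tau] and [c], the vectors [w1] and [w2] have integer coordinates, so
    their determinant is [|c|^2 Im tau] times an integer. Its absolute value 1 makes that integer
    nonzero. *)
Lemma lattice_scale_bound (L : C -> Prop) (tau c w1 w2 : C) :
  (forall z, L z <-> exists w, lattice_of tau w /\ z = Cmult c w) ->
  L w1 -> L w2 -> Rabs (fst w1 * snd w2 - fst w2 * snd w1) = 1 -> 0 < Im tau ->
  (fst c ^ 2 + snd c ^ 2) * Im tau <= 1.
Proof.
  intros HL H1 H2 Hdet Htau.
  apply HL in H1. apply HL in H2.
  destruct H1 as (z1 & (m1 & n1 & ->) & ->). destruct H2 as (z2 & (m2 & n2 & ->) & ->).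
  set (S := (fst c ^ 2 + snd c ^ 2) * Im tau) in *.
  assert (HS : 0 <= S).
  { apply Rmult_le_pos; [|lra].
    pose proof (pow2_ge_0 (fst c)). pose proof (pow2_ge_0 (snd c)). lra. }
  set (k := (n1 * m2 - m1 * n2)%Z).
  assert (E : Rabs (S * IZR k) = 1).
  { rewrite <- Hdet. f_equal. unfold S, k, Im.
    rewrite minus_IZR, !mult_IZR. destruct c, tau. simpl. ring. }
  rewrite Rabs_mult, (Rabs_pos_eq S), <- abs_IZR in E by auto.
  assert (Hk : (1 <= Z.abs k)%Z).
  { destruct (Z.eq_dec k 0) as [K|K]; [|lia].
    rewrite K in E. simpl in E. lra. }
  apply IZR_le in Hk. nra.
Qed.

(** In dimension two the area density scales by [f^2], so [area g] is the second moment of [f] for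
    the probability measure of [g0]. *)
Lemma variance_eq (g g0 : metric) (f : R -> R -> R) :
  continuous_2d (area_density g0) -> area g0 = 1 -> conformal_factor g g0 f ->
  variance g0 f = area g - mean g0 f ^ 2.
Proof.
  intros CJ Ha [[Hf _] Hc].
  pose proof (smooth_continuous_2d _ Hf) as Cf.
  set (J := area_density g0) in *. set (m := mean g0 f).
  assert (Hg : area g = square_int (fun x y => f x y * f x y * J x y)).
  { apply square_int_ext. intros x y. rewrite Rmult_1_l.
    destruct (Hc x y) as (Hp & HE & HF & HG).
    unfold area_density. rewrite HE, HF, HG.
    replace (f x y ^ 2 * gE g0 x y * (f x y ^ 2 * gG g0 x y) - (f x y ^ 2 * gF g0 x y) ^ 2)
      with ((f x y * f x y) ^ 2 * (gE g0 x y * gG g0 x y - gF g0 x y ^ 2)) by ring.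
    pose proof (metric_det_pos g0 x y).
    rewrite sqrt_mult by (try apply pow2_ge_0; lra).
    rewrite sqrt_pow2 by nra. reflexivity. }
  assert (Hm : m = square_int (fun x y => f x y * J x y)) by reflexivity.
  assert (H1 : square_int J = 1).
  { rewrite <- Ha. apply square_int_ext. intros. unfold J. ring. }
  transitivity (square_int (fun x y => f x y * f x y * J x y +
     ((-2 * m) * (f x y * J x y) + m ^ 2 * J x y))).
  { apply square_int_ext. intros x y. fold m J. ring. }
  assert (CfJ : continuous_2d (fun x y => f x y * J x y)) by now apply continuous_2d_mult.
  assert (C2 : continuous_2d (fun x y => (-2 * m) * (f x y * J x y))).
  { apply continuous_2d_mult; auto. apply continuous_2d_const. }
  assert (C3 : continuous_2d (fun x y => m ^ 2 * J x y)).
  { apply continuous_2d_mult; auto. apply continuous_2d_const. }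
  rewrite square_int_plus, square_int_plus, !square_int_scal, <- Hg, <- Hm, H1; auto.
  - ring.
  - repeat apply continuous_2d_mult; auto.
  - now apply continuous_2d_plus.
Qed.

Theorem theorem4p1 :
  forall (g g0 : metric) (f : R -> R -> R) (L : C -> Prop)
         (tau : C) (sigma : R),
    flat_with_deck_lattice g0 L ->
    area g0 = 1 ->
    conformal_factor g g0 f ->
    closure fundamental_domain tau ->
    similar L (lattice_of tau) ->
    0 < sigma ->
    sigma ^ 2 = Im tau ->
    area g - sigma ^ 2 * sys g ^ 2 >= variance g0 f.
Proof.
  intros g g0 f L tau sigma (Phi & (HPhi & Psi & HPsi & Hinv1 & Hinv2) & Hp & HdL & HLd)
    Ha Hc _ (c & Hc0 & HL) Hsig Htau.
  pose proof (continuous_2d_area_density g0 Phi HPhi Hp) as CJ.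
  rewrite (variance_eq g g0 f) by auto.
  destruct (HdL 1%Z 0%Z) as (w1 & Lw1 & Hw1). destruct (HdL 0%Z 1%Z) as (w2 & Lw2 & Hw2).
  assert (Hq : quasi_periodic Phi w1 w2) by now split.
  destruct (jac_constant_sign g0 Phi HPhi Hp) as (e & He & HJ).
  assert (Harea : square_int (area_density g0) = 1).
  { rewrite <- Ha. apply square_int_ext. intros. ring. }
  (* The determinant is the integral of the Jacobian, that is the unit area up to the sign [e]. *)
  assert (Hdet : Rabs (fst w1 * snd w2 - fst w2 * snd w1) = 1).
  { rewrite <- (square_int_jac Phi) by auto.
    rewrite (square_int_ext _ _ HJ), square_int_scal in Harea by now apply continuous_2d_jac.
    rewrite <- (Rmult_1_l (Rabs _)), <- He, <- Rabs_mult, Harea, He. apply Rabs_R1. }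
  assert (Hscale : (fst c ^ 2 + snd c ^ 2) * sigma ^ 2 <= 1).
  { rewrite Htau. apply (lattice_scale_bound L tau c w1 w2); auto.
    rewrite <- Htau. now apply pow_lt. }
  assert (Lc : L c).
  { apply HL. exists (RtoC 1). split.
    - exists 0%Z, 1%Z. rewrite Cmult_0_l, Cplus_0_l. reflexivity.
    - now rewrite Cmult_1_r. }
  destruct (HLd c Lc) as (m & n & Hmn).
  assert (Hmn0 : (m, n) <> (0, 0)%Z).
  { intros E. injection E as -> ->. apply Hc0.
    specialize (Hmn 0 0). rewrite !Rplus_0_r in Hmn.
    destruct (Phi 0 0) as [a b]. destruct c as [c1 c2].
    injection Hmn as E1 E2. apply injective_projections; simpl; lra. }
  pose proof Hc as [[Hf Hper] Hpos].
  (* The conformal factor in flat coordinates: [Psi] turns translation by [w1] or [w2] into a unit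
     shift, so [k] has both as periods. *)
  set (k u v := f (fst (Psi u v)) (snd (Psi u v))).
  pose proof HPsi as [HP HQ].
  pose proof (C1_2d_comp _ _ _ _ _ _ _ _ _
    (smooth_C1_2d _ Hf) (smooth_C1_2d _ HP) (smooth_C1_2d _ HQ)) as Hk.
  destruct (square_int_segment_mean Phi w1 w2 k _ _ (fst c) (snd c) HPhi Hq Hk) as [CA HA].
  { intros u v. unfold k. rewrite (deck_translation_inverse Phi Psi 1 0 w1) by auto.
    simpl. rewrite Rplus_0_r. apply Hper. }
  { intros u v. unfold k. rewrite (deck_translation_inverse Phi Psi 0 1 w2) by auto.
    simpl. rewrite Rplus_0_r. apply Hper. }
  pose (A := (fun x y =>
    RInt (fun r => k (fst (Phi x y) + r * fst c) (snd (Phi x y) + r * snd c)) 0 1)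
    : R -> R -> R).
  fold A in CA, HA.
  change (square_int (fun x y => A x y * jac Phi x y) =
    square_int (fun x y => k (fst (Phi x y)) (snd (Phi x y)) * jac Phi x y)) in HA.
  set (l := sqrt (fst c ^ 2 + snd c ^ 2)).
  assert (Hlen : forall x y, sys g <= l * A x y).
  { intros x y.
    replace (l * A x y)
      with (length g (flat_segment Psi (fst (Phi x y)) (snd (Phi x y)) (fst c) (snd c)))
      by now apply (length_flat_segment g g0 f Phi Psi).
    apply sys_le_length.
    now apply (flat_segment_noncontractible Phi Psi m n c). }
  assert (HAm : square_int (fun x y => A x y * area_density g0 x y) = mean g0 f).
  { assert (CAJ : continuous_2d (fun x y => A x y * jac Phi x y))
      by (apply continuous_2d_mult; auto; now apply continuous_2d_jac).
    assert (CfJ : continuous_2d (fun x y => f x y * jac Phi x y)).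
    { apply continuous_2d_mult; [now apply smooth_continuous_2d | now apply continuous_2d_jac]. }
    transitivity (e * square_int (fun x y => A x y * jac Phi x y)).
    - rewrite <- square_int_scal by auto. apply square_int_ext. intros x y. rewrite HJ. ring.
    - rewrite HA. rewrite (square_int_ext _ (fun x y => f x y * jac Phi x y)).
      + rewrite <- square_int_scal by auto.
        apply square_int_ext. intros x y. rewrite HJ. ring.
      + intros x y. unfold k. now rewrite Hinv1. }
  (* Integrates [Hlen] against the area measure of [g0], whose total mass is 1. *)
  assert (Hsys : sys g <= l * mean g0 f).
  { rewrite <- HAm, <- square_int_scal by now apply continuous_2d_mult.
    rewrite <- (Rmult_1_r (sys g)), <- Harea, <- square_int_scal by auto.
    apply square_int_le.
    - apply continuous_2d_mult; auto. apply continuous_2d_const.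
    - apply continuous_2d_mult; [apply continuous_2d_const | now apply continuous_2d_mult].
    - intros x y. pose proof (area_density_pos g0 x y). pose proof (Hlen x y). nra. }
  pose proof (sys_nonneg g) as Hs0.
  assert (Hl2 : l ^ 2 = fst c ^ 2 + snd c ^ 2).
  { unfold l. apply pow2_sqrt.
    pose proof (pow2_ge_0 (fst c)). pose proof (pow2_ge_0 (snd c)). lra. }
  rewrite <- Hl2 in Hscale.
  assert (H2 : sys g ^ 2 <= (l * mean g0 f) ^ 2) by (apply pow_incr; lra).
  assert (H3 : sigma ^ 2 * sys g ^ 2 <= sigma ^ 2 * (l * mean g0 f) ^ 2)
    by (apply Rmult_le_compat_l; auto; apply pow2_ge_0).
  assert (H4 : (l ^ 2 * sigma ^ 2) * mean g0 f ^ 2 <= 1 * mean g0 f ^ 2)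
    by (apply Rmult_le_compat_r; auto; apply pow2_ge_0).
  replace (sigma ^ 2 * (l * mean g0 f) ^ 2) with (l ^ 2 * sigma ^ 2 * mean g0 f ^ 2) in H3 by ring.
  lra.
Qed.
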